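(* Let $A$ be an $n\times n$ irreducible stochastic matrix of rank two with nonzero eigenvalues $1$ and $\lambda$. Then $|\mathcal P_+(A)|=\infty$ if and only if $A$ is permutationally similar to $$\frac{1}{1+\alpha}\begin{pmatrix} (\alpha+\lambda)\mathbf 1_{n_1}w^\top & (1-\lambda)\mathbf 1_{n_1}v^\top\\ \alpha(1-\lambda)\mathbf 1_{n_2}w^\top & (1+\alpha\lambda)\mathbf 1_{n_2}v^\top\end{pmatrix}$$ for some $n_1,n_2\in\mathbb N$ with $n_1+n_2=n$, some entrywise positive vectors $w\in\mathbb R^{n_1}$, $v\in\mathbb R^{n_2}$ satisfying $w^\top\mathbf 1_{n_1}=v^\top\mathbf 1_{n_2}=1$, and some $\alpha$, where either $\lambda>0$ and $\alpha>0$, or $\lambda<0$ and $\alpha=1$. Furthermore, if $A$ is of this form with $\lambda>0$, then $\mathcal P_+(A)=\mathbb N$; and if $A$ is of this form with $\lambda<0$ and $\alpha=1$, then $\mathcal P_+(A)$ is the set of all odd positive integers.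
   Context: $\mathbb N=\{1,2,3,\dots\}$. A stochastic matrix is an entrywise nonnegative real square matrix with every row sum equal to $1$. For an $n\times n$ stochastic matrix $A$, $\mathcal P_+(A):=\{c\in\mathbb N : B^c=A \text{ for some } n\times n \text{ stochastic matrix } B\}$. $\mathbf 1_m$ denotes the $m\times 1$ all-ones column vector. Two matrices $X,Y$ are permutationally similar if $Y=P^\top XP$ for some permutation matrix $P$. *)

(* Defs.v *)
From mathcomp Require Import all_boot all_order all_algebra.
From mathcomp Require Import perm.
From mathcomp Require Import classical_sets cardinality reals.

Set Implicit Arguments.
Unset Strict Implicit.
Unset Printing Implicit Defensive.

Import Order.TTheory GRing.Theory Num.Theory.

Local Open Scope classical_set_scope.
Local Open Scope ring_scope.

Definition stochastic (R : realType) (n : nat) (A : 'M[R]_n) : Prop :=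
  (forall i j, 0 <= A i j) /\ (forall i, \sum_j A i j = 1).

Definition perm_similar (R : realType) (n : nat) (X Y : 'M[R]_n) : Prop :=
  exists s : 'S_n, Y = (perm_mx s)^T *m X *m perm_mx s.

Definition reducible (R : realType) (n : nat) (A : 'M[R]_n) : Prop :=
  exists (n1 n2 : nat) (e : (n1 + n2)%N = n)
         (B : 'M[R]_n1) (C : 'M[R]_(n1, n2)) (D : 'M[R]_n2),
    [/\ (0 < n1)%N, (0 < n2)%N
      & perm_similar A (castmx (e, e) (block_mx B C 0 D))].

(* For n = 1 this makes the zero matrix irreducible, and for n = 0 the empty
   matrix; neither has rank two. *)
Definition irreducible (R : realType) (n : nat) (A : 'M[R]_n) : Prop :=
  ~ reducible A.

(* s lists the nonzero eigenvalues of A with their algebraic multiplicities.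
   The subtraction never truncates: a degree count gives size s <= n. *)
Definition nonzero_eigenvalues (R : realType) (n : nat) (A : 'M[R]_n)
    (s : seq R) : Prop :=
  0 \notin s /\
  char_poly A = 'X^(n - size s) * \prod_(z <- s) ('X - z%:P).

Definition Pplus (R : realType) (n : nat) (A : 'M[R]_n) : set nat :=
  [set c | (0 < c)%N /\ exists B : 'M[R]_n, stochastic B /\ B ^+ c = A].

Definition ones (R : realType) (m : nat) : 'cV[R]_m := const_mx 1.

Definition rank_two_form (R : realType) (n1 n2 : nat) (alpha lambda : R)
    (w : 'cV[R]_n1) (v : 'cV[R]_n2) : 'M[R]_(n1 + n2) :=
  (1 + alpha)^-1 *:
    block_mx ((alpha + lambda) *: (ones R n1 *m w^T))
             ((1 - lambda) *: (ones R n1 *m v^T))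
             ((alpha * (1 - lambda)) *: (ones R n2 *m w^T))
             ((1 + alpha * lambda) *: (ones R n2 *m v^T)).

Definition has_rank_two_form (R : realType) (n : nat) (alpha lambda : R)
    (A : 'M[R]_n) : Prop :=
  exists (n1 n2 : nat) (e : (n1 + n2)%N = n) (w : 'cV[R]_n1) (v : 'cV[R]_n2),
    [/\ (0 < n1)%N /\ (0 < n2)%N,
        (forall i, 0 < w i 0) /\ (forall j, 0 < v j 0),
        w^T *m ones R n1 = 1%:M /\ v^T *m ones R n2 = 1%:M
      & perm_similar A (castmx (e, e) (rank_two_form alpha lambda w v))].

(* Main.v *)
Require Import Defs.
From mathcomp Require Import all_boot all_order all_algebra.
From mathcomp Require Import perm.
From mathcomp Require Import ring lra.
From mathcomp Require Import boolp classical_sets cardinality reals.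

Set Implicit Arguments.
Unset Strict Implicit.
Unset Printing Implicit Defensive.

Import Order.TTheory GRing.Theory Num.Theory.

Local Open Scope classical_set_scope.
Local Open Scope ring_scope.

(** Perron-Frobenius theory gives A a positive stationary row p, and rank two
    together with the trace then forces the spectral decomposition
    A = 1 p + lambda x y, where p 1 = y x = 1, p x = y 1 = 0 and lambda <> 1
    ([irreducible_two_mode]). Write G(mu) = 1 p + mu x y ([two_mode]); these
    matrices satisfy G(mu) G(nu) = G(mu nu), so A = G(lambda).

    Let B be a stochastic c-th root of A. It commutes with A, whose
    eigenvalues 1 and lambda are simple, so B fixes 1 and p and multiplies x
    and y by a real mu with mu^c = lambda ([two_mode_root_modes]); for lambda < 0
    this already makes c odd. Moreover B - G(mu) is nilpotent and annihilated by
    G(mu), so that B^k = G(mu^k) as soon as k >= n, a bound independent of c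
    ([two_mode_root_exp]).

    If there are roots of arbitrarily large order c, then |mu| tends to 1. Fixing
    an even k >= n and letting c grow, the nonnegative matrices G(mu^k) converge
    to G(1), so G(1) is a stochastic idempotent; if lambda < 0, an odd k shows
    in the same way that G(-1) >= 0 ([two_mode_infinite_root]). The maximum
    principle for G(1), with p > 0, forces x to take exactly two values, one
    positive and one negative, and determines y from p
    ([two_mode_two_values]). Sorting the indices by the value of x puts G(lambda)
    into the block form, where alpha is the ratio of the stationary masses of the
    two blocks; G(-1) >= 0 says that each mass is at least the other, hence
    alpha = 1 ([two_mode_has_form]).

    Conversely the block form is itself a family G(mu) with G(mu) stochastic for
    0 <= mu <= 1, and for -1 <= mu <= 1 when alpha = 1, so real c-th roots of
    lambda in that range give stochastic c-th roots of A
    ([has_rank_two_form_root]). *)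

(** * Simultaneous permutations of rows and columns *)

Lemma perm_mx_conjE (R : realType) n (s : 'S_n) (X : 'M[R]_n) i j :
  ((perm_mx s)^T *m X *m perm_mx s) i j = X ((s^-1)%g i) ((s^-1)%g j).
Proof.
rewrite tr_perm_mx -{2}[s]invgK -row_permE -col_permE /row_perm /col_perm.
by rewrite !mxE.
Qed.

Lemma perm_similar_of_inj (R : realType) n (A Y : 'M[R]_n) (t : 'I_n -> 'I_n) :
  injective t -> (forall i j, Y i j = A (t i) (t j)) -> perm_similar A Y.
Proof.
move=> t_inj defY; exists ((perm t_inj)^-1)%g; apply/matrixP=> i j.
by rewrite perm_mx_conjE invgK !permE defY.
Qed.

Lemma perm_similar_entries (R : realType) n (A Y : 'M[R]_n) :
  perm_similar A Y -> exists s : 'S_n, forall i j, A i j = Y (s i) (s j).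
Proof.
by case=> s ->; exists s => i j; rewrite perm_mx_conjE !permK.
Qed.

(** Listing S before its complement turns A into a two by two block matrix;
    both reducibility and the rank-two form are reached this way. *)
Lemma perm_similar_block (R : realType) n (A : 'M[R]_n) (S : {set 'I_n}) :
  let f := @enum_val 'I_n (mem S) in
  let g := @enum_val 'I_n (mem (~: S)) in
  exists e : (#|S| + #|~: S| = n)%N,
    perm_similar A (castmx (e, e)
      (block_mx (mxsub f f A) (mxsub f g A) (mxsub g f A) (mxsub g g A))).
Proof.
move=> f g.
have e : (#|S| + #|~: S| = n)%N by rewrite cardsC card_ord.
exists e.
pose t (k : 'I_n) := match split (cast_ord (esym e) k) with
                     | inl i => f i | inr j => g j end.
have fS i : f i \in S by exact: enum_valP.
have gS i : g i \notin S by have := enum_valP i; rewrite inE.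
apply: (@perm_similar_of_inj _ _ _ _ t).
  move=> k l; rewrite /t.
  case: splitP => i ei; case: splitP => j ej => eqt.
  - by apply: val_inj; rewrite /= in ei ej *; rewrite ei ej (enum_val_inj eqt).
  - by have := fS i; rewrite eqt (negbTE (gS j)).
  - by have := gS i; rewrite eqt (fS j).
  - by apply: val_inj; rewrite /= in ei ej *; rewrite ei ej (enum_val_inj eqt).
by move=> i j; rewrite castmxE /= /t !mxE; case: (split (cast_ord _ i)) => ?;
  rewrite !mxE; case: (split (cast_ord _ j)) => ?; rewrite !mxE.
Qed.

(** The form in which irreducibility is used below: no transition can leave a
    closed set S, so S carries all the indices. *)
Lemma irreducible_closed_set (R : realType) n (A : 'M[R]_n) (S : {set 'I_n}) i :
  irreducible A -> (forall k l, k \in S -> l \notin S -> A k l = 0) ->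
  i \in S -> forall j, j \in S.
Proof.
move=> irrA clS iS j; apply/negPn/negP => jS; have {}jS : j \in ~: S by rewrite inE.
case: irrA; have [e simA] := perm_similar_block A (~: S).
move: e simA.
set f := @enum_val _ (mem (~: S)); set g := @enum_val _ (mem (~: ~: S)).
move=> e simA.
exists #|~: S|, #|~: ~: S|, e, (mxsub f f A), (mxsub f g A), (mxsub g g A).
split; [by rewrite (cardD1 j) jS | by rewrite (cardD1 i) finset.setCK iS |].
suff <- : mxsub g f A = 0 by [].
apply/matrixP=> k l; rewrite !mxE; apply: clS.
  by have := enum_valP k; rewrite !inE negbK.
by have := enum_valP l; rewrite inE.
Qed.

Lemma Pplus_perm_similar (R : realType) n (A Y : 'M[R]_n) c :
  perm_similar A Y -> Pplus Y c -> Pplus A c.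
Proof.
move=> [s defY] [c0 [B [[B0 B1] Bc]]]; split=> //.
exists (perm_mx s *m B *m (perm_mx s)^T).
have sE : perm_mx s *m (perm_mx s)^T = 1%:M :> 'M[R]_n.
  by rewrite tr_perm_mx -perm_mxM mulgV perm_mx1.
have sE' : (perm_mx s)^T *m perm_mx s = 1%:M :> 'M[R]_n.
  by rewrite tr_perm_mx -perm_mxM mulVg perm_mx1.
have BE i j : (perm_mx s *m B *m (perm_mx s)^T) i j = B (s i) (s j).
  by rewrite tr_perm_mx -row_permE -col_permE !mxE.
split.
  split=> [i j|i]; first by rewrite BE.
  under eq_bigr do rewrite BE.
  by rewrite -(B1 (s i)) [RHS](reindex_inj (@perm_inj _ s)).
have powE k : (perm_mx s *m B *m (perm_mx s)^T) ^+ k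
    = perm_mx s *m (B ^+ k) *m (perm_mx s)^T.
  elim: k => [|k IHk]; first by rewrite !expr0 mulmx1 sE.
  rewrite !exprS IHk -!mulmxE !mulmxA; congr (_ *m _ *m _).
  by rewrite -(mulmxA (perm_mx s *m B)) sE' mulmx1.
by rewrite powE Bc defY !mulmxA sE mul1mx -mulmxA sE mulmx1.
Qed.

(** * The stochastic matrices with two prescribed spectral projections *)

Lemma stochastic_ones (R : realType) n (A : 'M[R]_n) :
  stochastic A -> A *m ones R n = ones R n.
Proof.
case=> _ A1; apply/matrixP=> i j; rewrite !mxE -(A1 i).
by apply: eq_bigr => k _; rewrite mxE mulr1.
Qed.

(** The left and right eigenvectors of the two modes: 1 and p for the
    eigenvalue 1, x and y for the other one. *)
Definition biorthonormal (R : realType) n (p y : 'rV[R]_n) (x : 'cV[R]_n) :=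
  [/\ p *m ones R n = 1%:M, p *m x = 0, y *m ones R n = 0 & y *m x = 1%:M].

Definition two_mode (R : realType) n (p y : 'rV[R]_n) (x : 'cV[R]_n) (mu : R)
    : 'M[R]_n :=
  ones R n *m p + mu *: (x *m y).

Section TwoMode.
Variables (R : realType) (n : nat) (p y : 'rV[R]_n) (x : 'cV[R]_n).
Hypothesis pyx : biorthonormal p y x.

Let p1 : p *m ones R n = 1%:M. Proof. by case: pyx. Qed.
Let px : p *m x = 0. Proof. by case: pyx. Qed.
Let y1 : y *m ones R n = 0. Proof. by case: pyx. Qed.
Let yx : y *m x = 1%:M. Proof. by case: pyx. Qed.

Lemma two_modeE mu i j : two_mode p y x mu i j = p 0 j + mu * (x i 0 * y 0 j).
Proof. by rewrite !mxE !big_ord1 !mxE mul1r. Qed.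

Lemma two_mode_ones mu : two_mode p y x mu *m ones R n = ones R n.
Proof.
by rewrite mulmxDl -scalemxAl -!mulmxA p1 y1 mulmx0 scaler0 addr0 mulmx1.
Qed.

Lemma two_mode_col mu : two_mode p y x mu *m x = mu *: x.
Proof. by rewrite mulmxDl -scalemxAl -!mulmxA px yx mulmx0 add0r mulmx1. Qed.

Lemma mul_left_two_mode (u : 'rV[R]_n) mu :
  u *m two_mode p y x mu = (u *m ones R n) *m p + mu *: ((u *m x) *m y).
Proof. by rewrite mulmxDr -scalemxAr !mulmxA. Qed.

Lemma left_two_mode mu : p *m two_mode p y x mu = p.
Proof. by rewrite mul_left_two_mode p1 px mul0mx scaler0 addr0 mul1mx. Qed.

Lemma row_two_mode mu : y *m two_mode p y x mu = mu *: y.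
Proof. by rewrite mul_left_two_mode y1 yx mul0mx add0r mul1mx. Qed.

Lemma mul_right_two_mode (B : 'M[R]_n) mu nu :
  B *m ones R n = ones R n -> B *m x = mu *: x ->
  B *m two_mode p y x nu = two_mode p y x (mu * nu).
Proof.
move=> B1 Bx; rewrite mulmxDr -scalemxAr !mulmxA B1 Bx -scalemxAl scalerA.
by rewrite mulrC.
Qed.

Lemma mul_two_mode mu nu :
  two_mode p y x mu *m two_mode p y x nu = two_mode p y x (mu * nu).
Proof. exact: mul_right_two_mode (two_mode_ones mu) (two_mode_col mu). Qed.

Lemma two_mode_exp mu c : (0 < c)%N ->
  two_mode p y x mu ^+ c = two_mode p y x (mu ^+ c).
Proof.
case: c => // c _; elim: c => [|c IHc]; first by rewrite !expr1.
by rewrite exprS IHc -mulmxE mul_two_mode -exprS.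
Qed.

(** B commutes with its power A, so it preserves the eigenlines of A. Since
    lambda differs from 0 and 1, the eigenline for lambda is spanned by x: an
    eigenvector is killed by p, and the image of A is spanned by 1 and x. The
    eigenvalue mu of B on x is therefore real. *)
Lemma two_mode_root_modes (B : 'M[R]_n) c lambda :
  B *m ones R n = ones R n -> lambda != 0 -> lambda != 1 -> (0 < c)%N ->
  B ^+ c = two_mode p y x lambda ->
  exists mu, [/\ B *m x = mu *: x, p *m B = p, y *m B = mu *: y
               & mu ^+ c = lambda].
Proof.
set A := two_mode _ _ _ _ => B1 l0 l1 c0 Bc.
have comAB : A *m B = B *m A by rewrite -Bc !mulmxE -exprS -exprSr.
have ABx : A *m (B *m x) = lambda *: (B *m x).
  by rewrite mulmxA comAB -mulmxA two_mode_col scalemxAr.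
have pBx : p *m (B *m x) = 0.
  apply/eqP; have : p *m (A *m (B *m x)) = p *m (B *m x).
    by rewrite mulmxA left_two_mode.
  rewrite ABx -scalemxAr => /eqP; rewrite -subr_eq0 -{2}[p *m _]scale1r -scalerBl.
  by rewrite scaler_eq0 subr_eq0 (negbTE l1).
exists ((y *m (B *m x)) 0 0).
set mu := _ 0 0.
have yBx : y *m (B *m x) = mu%:M by rewrite [LHS]mx11_scalar.
have Bx : B *m x = mu *: x.
  apply: (scalerI l0); rewrite -ABx mulmxDl -scalemxAl -!mulmxA pBx yBx.
  by rewrite mulmx0 add0r mul_mx_scalar.
have pB : p *m B = p.
  have : p *m B *m A = p *m B by rewrite -mulmxA -comAB mulmxA left_two_mode.
  rewrite mul_left_two_mode -!(mulmxA _ B) B1 Bx -scalemxAr px p1 scaler0 mul0mx.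
  by rewrite scaler0 addr0 mul1mx => <-.
have yB : y *m B = mu *: y.
  apply: (scalerI l0).
  have : y *m B *m A = lambda *: (y *m B).
    by rewrite -mulmxA -comAB mulmxA row_two_mode scalemxAl.
  rewrite mul_left_two_mode -!(mulmxA _ B) B1 Bx -scalemxAr yx y1 mul0mx add0r => <-.
  by rewrite -scalemxAl mul1mx.
split=> //.
have Bkx k : B ^+ k *m x = mu ^+ k *: x.
  elim: k => [|k IHk]; first by rewrite !expr0 mul1mx scale1r.
  by rewrite exprSr -mulmxE -mulmxA Bx -scalemxAr IHk scalerA -exprS.
have /(congr1 (mulmx y)) : mu ^+ c *: x = lambda *: x.
  by rewrite -Bkx Bc two_mode_col.
rewrite -!scalemxAr yx => /matrixP/(_ 0 0).
by rewrite !mxE !mulr1.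
Qed.
End TwoMode.

(** The minimal polynomial is a power of X of degree at most n. *)
Lemma nilpotent_exp_size (F : fieldType) n (N : 'M[F]_n) c k :
  N ^+ c = 0 -> (n <= k)%N -> N ^+ k = 0.
Proof.
case: n N => [|n] N Nc nk; first exact: flatmx0.
have : mxminpoly N %| ('X - 0%:P) ^+ c.
  by rewrite mxminpoly_min // polyC0 subr0 rmorphXn /= horner_mx_X.
case/dvdp_exp_XsubCP=> d _; rewrite polyC0 subr0 => minX.
have dn : (d <= n.+1)%N.
  have := dvdp_leq (monic_neq0 (char_poly_monic N)) (mxminpoly_dvd_char N).
  by rewrite (eqp_size minX) size_polyXn size_char_poly.
have Nd : N ^+ d = 0.
  have /mxminpoly_minP : mxminpoly N %| 'X^d by rewrite (eqp_dvdl _ minX).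
  by rewrite rmorphXn /= horner_mx_X.
by rewrite -(subnK (leq_trans dn nk)) exprD Nd mulr0.
Qed.

(** B is determined by mu up to a nilpotent part N supported on the common
    kernel of p and y. The exponent that kills N depends on n and not on c; this
    uniformity is what allows letting c grow with k fixed. *)
Lemma two_mode_root_exp (R : realType) n (p y : 'rV[R]_n) (x : 'cV[R]_n)
    (B : 'M[R]_n) c mu k :
  biorthonormal p y x -> (0 < c)%N ->
  B *m ones R n = ones R n -> B *m x = mu *: x ->
  p *m B = p -> y *m B = mu *: y ->
  B ^+ c = two_mode p y x (mu ^+ c) -> (0 < k)%N -> (n <= k)%N ->
  B ^+ k = two_mode p y x (mu ^+ k).
Proof.
move=> pyx c0 B1 Bx pB yB Bc k0 nk.
set G := two_mode p y x in Bc *; set N := B - G mu.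
have GN : G mu *m N = 0.
  rewrite mulmxBr (mul_two_mode pyx) mulmxDl -scalemxAl -!mulmxA pB yB.
  by rewrite -scalemxAr scalerA subrr.
have GNk m : G mu *m N ^+ m.+1 = 0 by rewrite exprS -mulmxE mulmxA GN mul0mx.
have powB m : B ^+ m.+1 = G (mu ^+ m.+1) + N ^+ m.+1.
  elim: m => [|m IHm]; first by rewrite !expr1 addrC subrK.
  rewrite exprS IHm -mulmxE mulmxDr (mul_right_two_mode _ _ _ B1 Bx) -exprS.
  congr (_ + _); rewrite -{1}[B](subrK (G mu)) mulmxDl GNk addr0.
  by rewrite [in RHS]exprS.
have Nc : N ^+ c = 0.
  move: Bc; case: c c0 => // c _; rewrite powB => /eqP.
  by rewrite addrC -subr_eq0 addrK => /eqP.
move: k0 (nilpotent_exp_size Nc nk); case: (k) => // m _.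
by rewrite powB => ->; rewrite addr0.
Qed.

(** * Irreducibility *)

(** Maximum principle: an index where b is maximal only has transitions to
    other such indices, so the set of maximizers is closed. *)
Lemma harmonic_const (R : realType) n (A : 'M[R]_n) (b : 'cV[R]_n) :
  stochastic A -> irreducible A -> A *m b = b -> forall i j, b i 0 = b j 0.
Proof.
move=> [A0 A1] irrA Ab i j.
pose k := [arg max_(k > i) b k 0]%O.
have bk l : b l 0 <= b k 0.
  by rewrite /k; case: Order.TotalTheory.arg_maxP => // ? _; exact.
suff bkE l : b l 0 = b k 0 by rewrite !bkE.
have kS : k \in [set l | b l 0 == b k 0]%SET by rewrite inE.
suff /irreducible_closed_set-/(_ k irrA kS l) :
  forall u v, u \in [set l | b l 0 == b k 0]%SET ->
    v \notin [set l | b l 0 == b k 0]%SET -> A u v = 0.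
  by rewrite inE => H; apply/eqP/H.
move=> u v; rewrite !inE => /eqP buE bvN.
have S0 : \sum_w A u w * (b k 0 - b w 0) = 0.
  under eq_bigr do rewrite mulrBr.
  rewrite sumrB -mulr_suml A1 mul1r -buE.
  by have /matrixP/(_ u 0) := Ab; rewrite mxE => ->; rewrite subrr.
have S_ge0 w : 0 <= A u w * (b k 0 - b w 0) by rewrite mulr_ge0 // subr_ge0.
have /eqP := @psumr_eq0P _ _ xpredT _ (fun w _ => S_ge0 w) S0 v isT.
by rewrite mulf_eq0 subr_eq0 [b k 0 == _]eq_sym (negbTE bvN) orbF => /eqP.
Qed.

(** Taking absolute values of the entries of q gives r with r A >= r, and both
    sides have the same total mass, so r A = r. The support of r is closed. *)
Lemma positive_stationary (R : realType) n (A : 'M[R]_n) (q : 'rV[R]_n) :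
  stochastic A -> irreducible A -> q *m A = q -> q != 0 ->
  exists p : 'rV[R]_n,
    [/\ p *m A = p, p *m ones R n = 1%:M & forall j, 0 < p 0 j].
Proof.
move=> [A0 A1] irrA qA q0.
pose r : 'rV[R]_n := \row_j `|q 0 j|.
have rA_ge j : 0 <= (r *m A) 0 j - r 0 j.
  rewrite subr_ge0 !mxE -{1}qA mxE (le_trans (ler_norm_sum _ _ _)) //.
  rewrite ler_sum // => i _.
  by rewrite normrM mxE (ger0_norm (A0 _ _)).
have rA_sum : \sum_j ((r *m A) 0 j - r 0 j) = 0.
  rewrite sumrB; apply/eqP; rewrite subr_eq0; apply/eqP.
  under eq_bigr do rewrite mxE.
  rewrite exchange_big /=; apply: eq_bigr => i _.
  by rewrite -mulr_sumr A1 mulr1.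
have rA : r *m A = r.
  apply/rowP=> j; apply/eqP; rewrite -subr_eq0; apply/eqP.
  exact: (psumr_eq0P (fun j _ => rA_ge j) rA_sum).
have r_ge0 j : 0 <= r 0 j by rewrite mxE normr_ge0.
have [i qi] : exists i, q 0 i != 0 by apply/rV0Pn.
have r_gt0 j : 0 < r 0 j.
  rewrite lt0r r_ge0 andbT.
  have iS : i \in [set j | r 0 j != 0]%SET by rewrite inE mxE normr_eq0.
  suff /irreducible_closed_set-/(_ i irrA iS j) :
    forall u v, u \in [set j | r 0 j != 0]%SET ->
      v \notin [set j | r 0 j != 0]%SET -> A u v = 0.
    by rewrite inE; apply.
  move=> u v; rewrite !inE negbK => ru /eqP rv.
  have : \sum_k r 0 k * A k v = 0 by have /matrixP/(_ 0 v) := rA; rewrite mxE rv.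
  move/(psumr_eq0P (fun k _ => mulr_ge0 (r_ge0 k) (A0 k v)))/(_ u isT)/eqP.
  by rewrite mulf_eq0 (negbTE ru) => /eqP.
pose s := \sum_j r 0 j.
have s_gt0 : 0 < s.
  by rewrite /s (bigD1 i) //= ltr_pwDl // sumr_ge0.
exists (s^-1 *: r); split=> [||j].
- by rewrite -scalemxAl rA.
- rewrite -scalemxAl; apply/matrixP=> a b; rewrite !ord1 !mxE.
  under eq_bigr do rewrite [X in _ * X]mxE mulr1.
  by rewrite eqxx mulVf ?gt_eqF.
- by rewrite mxE mulr_gt0 ?invr_gt0.
Qed.

(** * Spectral decomposition *)

(** The nonzero eigenvalue besides 1 enters the decomposition only through the
    trace. *)
Lemma char_poly_two_trace (R : realType) n (A : 'M[R]_n) lambda :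
  (1 < n)%N -> nonzero_eigenvalues A [:: 1; lambda] -> \tr A = 1 + lambda.
Proof.
case: n A => [|[|n]] // A _ [_ chA].
apply: oppr_inj; rewrite -char_poly_trace // chA /= !big_cons big_nil mulr1.
rewrite !subSS subn0 coefXnM ltnNge leqnSn /= subSnn.
rewrite mulrBl !coefB coefXM coefCM !coefB !coefX !coefC /=; ring.
Qed.

(** A' = A - 1 p annihilates 1 whereas p does not, so the row space of A is the
    direct sum of those of A' and p. Hence A' has rank one and trace lambda,
    that is A' = b z with z b = lambda, and x is b rescaled. The value
    lambda = 1 is excluded because x would be a nonconstant harmonic vector. *)
Lemma irreducible_two_mode (R : realType) n (A : 'M[R]_n) lambda :
  stochastic A -> irreducible A -> \rank A = 2%N ->
  nonzero_eigenvalues A [:: 1; lambda] ->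
  exists (p y : 'rV[R]_n) (x : 'cV[R]_n),
    [/\ biorthonormal p y x, forall j, 0 < p 0 j, A = two_mode p y x lambda,
        lambda != 0 & lambda != 1].
Proof.
move=> stA irrA rkA evA.
have n1 : (1 < n)%N by rewrite -rkA rank_leq_row.
have trA := char_poly_two_trace n1 evA.
case: evA => ev0 chA.
have l0 : lambda != 0.
  by apply: contra ev0 => /eqP->; rewrite !inE eqxx orbT.
have A1 := stochastic_ones stA.
have /eigenvalueP[q qA q0] : eigenvalue A 1.
  by rewrite eigenvalue_root_char chA big_cons !rootM root_XsubC eqxx orbT.
rewrite scale1r in qA.
have [p [pA p1 p_gt0]] := positive_stationary stA irrA qA q0.
pose A' := A - ones R n *m p.
have A'1 : A' *m ones R n = 0.
  by rewrite mulmxBl A1 -mulmxA p1 mulmx1 subrr.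
have pA' : p *m A' = 0 by rewrite mulmxBr pA mulmxA p1 mul1mx subrr.
have p0 : p != 0.
  apply/eqP => p_eq0; move: p1; rewrite p_eq0 mul0mx => /matrixP/(_ 0 0)/eqP.
  by rewrite !mxE eq_sym oner_eq0.
have rkA' : (\rank A' <= 1)%N.
  have sub : (A' + p <= A)%MS.
    have pA_sub : (p <= A)%MS by rewrite -pA submxMl.
    by rewrite addsmx_sub pA_sub andbT addmx_sub // eqmx_opp mulmx_sub.
  have disj : (A' :&: p <= (0 : 'M_n))%MS.
    apply/rV_subP=> v; rewrite sub_capmx => /andP[/submxP[u ->] /sub_rVP[k]] E.
    have /(congr1 (mulmx^~ (ones R n))) := E.
    rewrite -mulmxA A'1 mulmx0 -scalemxAl p1 => /matrixP/(_ 0 0).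
    by rewrite !mxE mulr1 E => <-; rewrite scale0r sub0mx.
  have := mxrankS sub; have := mxrank_adds_leqif A' p.
  rewrite disj => -[_ /eqP->].
  by rewrite rkA rank_rV p0 addn1.
have trA' : \tr A' = lambda.
  rewrite linearB /= trA mxtrace_mulC p1 mxtrace1; ring.
have A'0 : A' != 0.
  by apply: contra l0 => /eqP A'0; rewrite -trA' A'0 mxtrace0.
have [i zi] : exists i, row i A' != 0.
  apply/existsP; apply: contraNT A'0; rewrite negb_exists => /forallP H.
  by apply/eqP/row_matrixP=> i; move: (H i); rewrite negbK row0 => /eqP.
set z := row i A' in zi.
have [b defb] : exists b : 'cV_n, A' = b *m z.
  apply/submxP.
  have [_ <-] := mxrank_leqif_sup (row_sub i A').
  by rewrite eqn_leq mxrankS ?row_sub // rank_rV zi.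
have z1 : z *m ones R n = 0 by rewrite -row_mul A'1 row0.
have zb : z *m b = lambda%:M.
  by rewrite [LHS]mx11_scalar -trace_mx11 mxtrace_mulC -defb trA'.
have pb : p *m b = 0.
  have : (p *m b) *m z = 0 by rewrite -mulmxA -defb pA'.
  rewrite [p *m b]mx11_scalar mul_scalar_mx => /eqP.
  by rewrite scaler_eq0 (negbTE zi) orbF => /eqP ->; rewrite raddf0.
have pyx : biorthonormal p z (lambda^-1 *: b).
  split=> //; first by rewrite -scalemxAr pb scaler0.
  by rewrite -scalemxAr zb scale_scalar_mx mulVf.
have defA : A = two_mode p z (lambda^-1 *: b) lambda.
  by rewrite /two_mode -scalemxAl scalerA divff // scale1r -defb addrC subrK.
exists p, z, (lambda^-1 *: b); split=> //.
apply/eqP=> l1.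
have Ax : A *m (lambda^-1 *: b) = lambda^-1 *: b.
  by rewrite {1}defA two_mode_col // l1 scale1r.
have xC := harmonic_const stA irrA Ax.
have xE : lambda^-1 *: b = ((lambda^-1 *: b) i 0) *: ones R n.
  by apply/colP=> j; rewrite (xC j i) !mxE mulr1.
case: pyx => _ _ _; rewrite xE -scalemxAr z1 scaler0 => /matrixP/(_ 0 0)/eqP.
by rewrite !mxE eq_sym oner_eq0.
Qed.

(** * Passing to the limit along roots of unbounded order *)

(** Bernoulli's inequality for 1 / (1 - d), cleared of denominators so that
    m = 0 needs no separate treatment. *)
Lemma exp_bernoulli (R : realType) (m d : R) c :
  0 <= m -> m <= 1 - d -> 0 <= d -> m ^+ c * (1 + c%:R * d) <= 1.
Proof.
move=> m0 md d0; elim: c => [|c IHc]; first by rewrite expr0 mul0r addr0 mulr1.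
apply: le_trans IHc; rewrite exprSr -mulrA ler_wpM2l ?exprn_ge0 //.
have c0 : 0 <= c%:R :> R by [].
rewrite -natr1.
apply: (@le_trans _ _ ((1 - d) * (1 + (c%:R + 1) * d))); last by nra.
by rewrite ler_wpM2r // addr_ge0 // mulr_ge0 // addr_ge0.
Qed.

(** A c-th root m of a fixed L > 0 tends to 1 as c grows. If a + t < 0, then
    a + m t >= 0 keeps m below a fixed bound 1 - d < 1, and m ^ c = L fails for
    large c. *)
Lemma root_limit_ge0 (R : realType) (a t L : R) :
  0 < L -> 0 <= a ->
  (forall N, exists m c, [/\ (N <= c)%N, 0 <= m, m ^+ c = L & 0 <= a + m * t]) ->
  0 <= a + t.
Proof.
move=> L0 a0 H; rewrite leNgt; apply/negP=> at0.
have t0 : t < 0 by lra.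
pose d := 1 - a / - t.
have d0 : 0 < d by rewrite subr_gt0 ltr_pdivrMr; lra.
have [m [c [Nc m0 mc amt]]] := H (Num.Def.archi_bound (L * d)^-1).
have md : m <= 1 - d by rewrite /d opprB addrC subrK ler_pdivlMr; lra.
have Ld : 0 < L * d by rewrite mulr_gt0.
have := exp_bernoulli c m0 md (ltW d0); rewrite mc.
suff : 1 < c%:R * (L * d) by lra.
rewrite -ltr_pdivrMr // div1r.
apply: lt_le_trans (archi_boundP _) _; first by rewrite invr_ge0 ltW.
by rewrite ler_nat.
Qed.

Lemma infinite_nat_unbounded (C : set nat) N :
  infinite_set C -> exists2 c, C c & (N <= c)%N.
Proof.
move=> Cinf; apply: contrapT => H; apply: Cinf.
apply: sub_finite_set (finite_II N) => c Cc /=.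
by rewrite ltnNge; apply/negP=> Nc; apply: H; exists c.
Qed.

(** The exponents k = 2 (n + 1) and k = 2 n + 1 are at least n and have the
    parity that makes mu ^ k tend to 1, respectively to -1 when mu < 0. *)
Lemma two_mode_infinite_root (R : realType) n (p y : 'rV[R]_n) (x : 'cV[R]_n)
    lambda :
  biorthonormal p y x -> (forall j, 0 < p 0 j) -> lambda != 0 -> lambda != 1 ->
  infinite_set (Pplus (two_mode p y x lambda)) ->
  (forall i j, 0 <= two_mode p y x 1 i j) /\
  (lambda < 0 -> forall i j, 0 <= two_mode p y x (-1) i j).
Proof.
move=> pyx p0 l0 l1 Pinf.
have modes k N : (0 < k)%N -> (n <= k)%N -> exists mu c,
    [/\ (N <= c)%N, mu ^+ c = lambda
      & forall i j, 0 <= two_mode p y x (mu ^+ k) i j].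
  move=> k0 nk.
  have [c [c0 [B [[B0 B1] Bc]]] Nc] := infinite_nat_unbounded N Pinf.
  have Bones := stochastic_ones (conj B0 B1).
  have [mu [Bx pB yB muc]] := two_mode_root_modes pyx Bones l0 l1 c0 Bc.
  exists mu, c; split=> // i j; rewrite -muc in Bc.
  rewrite -(two_mode_root_exp pyx c0 Bones Bx pB yB Bc k0 nk).
  elim: k {k0 nk} i j => [|k IHk] i j; first by rewrite expr0 mxE.
  by rewrite exprS -mulmxE mxE sumr_ge0 // => h _; rewrite mulr_ge0.
have norm0 k : 0 < `|lambda| ^+ k by rewrite exprn_gt0 // normr_gt0.
split=> [i j|lneg i j].
  rewrite two_modeE // mul1r.
  apply: (root_limit_ge0 (norm0 n.+1.*2)); first exact: ltW.
  move=> N; have [||mu [c [Nc muc H]]] := modes n.+1.*2 N; rewrite ?double_gt0 //.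
    by rewrite -addnn; apply: leq_trans (leq_addr _ _).
  exists (`|mu| ^+ n.+1.*2), c; rewrite exprn_ge0 // -exprM mulnC exprM -normrX muc.
  split=> //; have := H i j; rewrite two_modeE //.
  by rewrite -[mu ^+ _]ger0_norm ?normrX // exprn_even_ge0 // odd_double.
rewrite two_modeE // mulN1r.
apply: (root_limit_ge0 (norm0 n.*2.+1)); first exact: ltW.
move=> N; have [||mu [c [Nc muc H]]] := modes n.*2.+1 N; rewrite ?double_gt0 //.
  by rewrite -addnn; apply: leqW; apply: leq_addr.
exists (`|mu| ^+ n.*2.+1), c; rewrite exprn_ge0 // -exprM mulnC exprM -normrX muc.
split=> //; have := H i j; rewrite two_modeE // mulrN -mulNr.
suff mu0 : mu < 0.
  by rewrite ltr0_norm // exprNn -signr_odd /= odd_double expr1 mulN1r opprK.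
rewrite ltNge; apply/negP=> mu_ge0.
by move: lneg; rewrite -muc ltNge exprn_ge0.
Qed.

(** * Maximum principle for the limit *)

(** Changing the sign of both x and y leaves x y unchanged and exchanges maxima
    and minima of x. *)
Lemma biorthonormalN (R : realType) n (p y : 'rV[R]_n) (x : 'cV[R]_n) :
  biorthonormal p y x -> biorthonormal p (- y) (- x).
Proof.
case=> p1 px y1 yx; split=> //.
- by rewrite mulmxN px oppr0.
- by rewrite mulNmx y1 oppr0.
- by rewrite mulmxN mulNmx opprK.
Qed.

(** G(1) fixes x and its row i averages the values of x to the maximum x i, so
    it gives no weight to the indices j where x is smaller:
    p j + x i * y j = 0. *)
Lemma two_mode_peak (R : realType) n (p y : 'rV[R]_n) (x : 'cV[R]_n) i :
  biorthonormal p y x -> (forall j, 0 < p 0 j) ->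
  (forall j k, 0 <= two_mode p y x 1 j k) -> (forall j, x j 0 <= x i 0) ->
  0 < x i 0 /\ forall j, x j 0 != x i 0 -> y 0 j = - p 0 j / x i 0.
Proof.
move=> pyx p0 E0 xi; have [p1 px y1 yx] := pyx.
have xi0 : 0 < x i 0.
  rewrite ltNge; apply/negP=> xi_le0.
  have : \sum_j p 0 j * - x j 0 = 0.
    have /matrixP/(_ 0 0) := px; rewrite !mxE => px0.
    by under eq_bigr do rewrite mulrN; rewrite sumrN px0 oppr0.
  have x_ge0 j : 0 <= p 0 j * - x j 0.
    by rewrite mulr_ge0 ?(ltW (p0 j)) // oppr_ge0 (le_trans (xi j)).
  move/(psumr_eq0P (fun j _ => x_ge0 j)) => px0.
  have x0 : x = 0.
    apply/colP=> j; move/eqP: (px0 j isT).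
    by rewrite mulf_eq0 gt_eqF //= oppr_eq0 mxE => /eqP.
  move: yx; rewrite x0 mulmx0 => /matrixP/(_ 0 0)/eqP.
  by rewrite !mxE eq_sym oner_eq0.
split=> // j xj.
have Ex : two_mode p y x 1 *m x = x by rewrite two_mode_col // scale1r.
have S0 : \sum_k two_mode p y x 1 i k * (x i 0 - x k 0) = 0.
  under eq_bigr do rewrite mulrBr.
  rewrite sumrB -mulr_suml.
  have /matrixP/(_ i 0) := Ex; rewrite mxE => ->.
  have /matrixP/(_ i 0) := two_mode_ones pyx 1; rewrite !mxE => Ei.
  rewrite (eq_bigr (fun k => two_mode p y x 1 i k * ones R n k 0)) ?Ei.
    by rewrite mul1r subrr.
  by move=> k _; rewrite [ones _ _ _ _]mxE mulr1.
have S_ge0 k : 0 <= two_mode p y x 1 i k * (x i 0 - x k 0).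
  by rewrite mulr_ge0 // subr_ge0.
have /eqP := @psumr_eq0P _ _ xpredT _ (fun k _ => S_ge0 k) S0 j isT.
rewrite mulf_eq0 subr_eq0 [x i 0 == _]eq_sym (negbTE xj) orbF two_modeE // => /eqP H.
apply: (mulfI (lt0r_neq0 xi0)).
by move: H; rewrite mul1r mulrCA mulfV ?gt_eqF // mulr1; lra.
Qed.

(** At an index where x is neither maximal nor minimal, the peak condition at
    the maximum M > 0 makes y negative and the one at the minimum m < 0 makes it
    positive. *)
Lemma two_mode_two_values (R : realType) n (p y : 'rV[R]_n) (x : 'cV[R]_n) :
  biorthonormal p y x -> (forall j, 0 < p 0 j) ->
  (forall j k, 0 <= two_mode p y x 1 j k) ->
  exists M m, [/\ m < 0 < M, exists i, x i 0 = M, exists i, x i 0 = m &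
    forall j, x j 0 = M /\ y 0 j = - p 0 j / m \/
              x j 0 = m /\ y 0 j = - p 0 j / M].
Proof.
move=> pyx p0 E0.
have [i0 _] : exists i0 : 'I_n, true.
  case: n p y x {p0 E0} pyx => [|n] p y x [p1 _ _ _]; last by exists ord0.
  move/matrixP/(_ 0 0)/eqP: p1.
  by rewrite !mxE big_ord0 eq_sym oner_eq0.
pose i := [arg max_(k > i0) x k 0]%O.
have xi l : x l 0 <= x i 0.
  by rewrite /i; case: Order.TotalTheory.arg_maxP => // ? _; exact.
pose h := [arg min_(k < i0) x k 0]%O.
have xh l : x h 0 <= x l 0.
  by rewrite /h; case: Order.TotalTheory.arg_minP => // ? _; exact.
have [xi0 yi] := two_mode_peak pyx p0 E0 xi.
have [||xh0 yh] := two_mode_peak (biorthonormalN pyx) p0 (i := h).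
- move=> j k; have := E0 j k; rewrite !two_modeE // !mxE; lra.
- by move=> j; rewrite !mxE lerN2.
rewrite mxE oppr_gt0 in xh0.
exists (x i 0), (x h 0); split; [by rewrite xh0 | by exists i | by exists h |].
have {}yh j : x j 0 != x h 0 -> y 0 j = - p 0 j / x h 0.
  move=> xj; have := yh j; rewrite !mxE eqr_opp => /(_ xj) H.
  by apply: oppr_inj; rewrite H invrN mulrN.
move=> j; have [xj|xj] := eqVneq (x j 0) (x i 0).
  by left; split=> //; apply: yh; rewrite xj gt_eqF // (lt_trans xh0).
right; split; last exact: yi.
apply/eqP/negPn/negP => xj'.
have : - p 0 j / x i 0 = - p 0 j / x h 0 by rewrite -yi // yh.
have := p0 j => pj.
have : - p 0 j / x i 0 < 0 by rewrite mulNr oppr_lt0 divr_gt0.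
have : 0 < - p 0 j / x h 0 by rewrite -mulrNN -invrN opprK divr_gt0 // oppr_gt0.
lra.
Qed.
(** * The block form *)

(** With a and b the masses that p gives to the two blocks, p x = 0 reads
    a M + b m = 0. This is the only relation between M and m, and with a + b = 1
    it yields every block with alpha = a / b. *)
Lemma two_mode_has_form (R : realType) n (p y : 'rV[R]_n) (x : 'cV[R]_n) :
  biorthonormal p y x -> (forall j, 0 < p 0 j) ->
  (forall j k, 0 <= two_mode p y x 1 j k) ->
  exists alpha, [/\ 0 < alpha,
    forall lambda, has_rank_two_form alpha lambda (two_mode p y x lambda) &
    (forall j k, 0 <= two_mode p y x (-1) j k) -> alpha = 1].
Proof.
move=> pyx p0 E0.
have [M [m [/andP[m0 M0] [iM xiM] [im xim] xyE]]] := two_mode_two_values pyx p0 E0.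
pose S := [set i | x i 0 == M]%SET.
have mM : m != M by rewrite lt_eqF // (lt_trans m0).
have xS j : j \in S -> x j 0 = M /\ y 0 j = - p 0 j / m.
  rewrite inE => /eqP xj; case: (xyE j) => -[xj' yj] //.
  by rewrite -xj' xj eqxx in mM.
have xT j : j \in ~: S -> x j 0 = m /\ y 0 j = - p 0 j / M.
  by rewrite !inE => xj; case: (xyE j) => -[xj' yj] //; rewrite xj' eqxx in xj.
have iMS : iM \in S by rewrite inE xiM.
have imT : im \in ~: S by rewrite !inE xim.
pose a := \sum_(j in S) p 0 j; pose b := \sum_(j in ~: S) p 0 j.
have a0 : 0 < a.
  by rewrite /a (bigD1 iM) //= ltr_pwDl // sumr_ge0 // => j _; exact: ltW.
have b0 : 0 < b.
  by rewrite /b (bigD1 im) //= ltr_pwDl // sumr_ge0 // => j _; exact: ltW.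
have [p1 px _ _] := pyx.
have splitS (F : 'I_n -> R) :
    \sum_j F j = \sum_(j in S) F j + \sum_(j in ~: S) F j.
  rewrite (bigID (mem S)) /=; congr (_ + _).
  by apply: eq_bigl => j; rewrite finset.in_setC.
have ab1 : a + b = 1.
  have /matrixP/(_ 0 0) := p1; rewrite !mxE eqxx mulr1n => <-; rewrite -splitS.
  by apply: eq_bigr => j _; rewrite mxE mulr1.
have abM : a * M + b * m = 0.
  have /matrixP/(_ 0 0) := px; rewrite !mxE => <-; rewrite splitS !mulr_suml.
  by congr (_ + _); apply: eq_bigr => j jS;
    [have [-> _] := xS j jS | have [-> _] := xT j jS].
have a_neq0 := lt0r_neq0 a0; have b_neq0 := lt0r_neq0 b0.
have M_neq0 := lt0r_neq0 M0; have m_neq0 := ltr0_neq0 m0.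
have mE : m = - (a * M / b).
  by apply: (mulfI b_neq0); rewrite mulrN mulrCA mulfV // mulr1; lra.
have alphaE : (1 + a / b)^-1 = b.
  apply: (mulfI (_ : 1 + a / b != 0)); last first.
    rewrite mulfV ?lt0r_neq0 ?addr_gt0 ?divr_gt0 //.
    by rewrite mulrDl mul1r divfK // addrC ab1.
  by rewrite lt0r_neq0 ?addr_gt0 ?divr_gt0.
exists (a / b); split; first by rewrite divr_gt0.
  move=> lambda.
  have [] := perm_similar_block (two_mode p y x lambda) S.
  set f := @enum_val _ _; set g := @enum_val _ _ => e simA.
  have fS i : f i \in S by exact: enum_valP.
  have gT i : g i \in ~: S by exact: enum_valP.
  exists #|S|, #|~: S|, e, (\col_i (p 0 (f i) / a)), (\col_i (p 0 (g i) / b)).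
  split.
  - by rewrite (cardD1 iM) iMS (cardD1 im) imT.
  - by split=> i; rewrite mxE divr_gt0.
  - split; apply/matrixP=> i j; rewrite !ord1 !mxE.
      under eq_bigr do rewrite !mxE mulr1.
      by rewrite -mulr_suml -(big_enum_val (A := mem S) (fun j => p 0 j)) mulfV.
    under eq_bigr do rewrite !mxE mulr1.
    by rewrite -mulr_suml -(big_enum_val (A := mem (~: S)) (fun j => p 0 j)) mulfV.
  - move: simA; congr (perm_similar _ (castmx _ _)).
    rewrite /rank_two_form scale_block_mx alphaE.
    congr block_mx; apply/matrixP=> i j;
      rewrite [LHS]mxE two_modeE // !mxE big_ord1 !mxE mul1r.
    + have [-> _] := xS _ (fS i); have [_ ->] := xS _ (fS j); rewrite mE.
      by field; rewrite a_neq0 b_neq0 M_neq0.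
    + have [-> _] := xS _ (fS i); have [_ ->] := xT _ (gT j).
      by field; rewrite b_neq0 M_neq0.
    + have [-> _] := xT _ (gT i); have [_ ->] := xS _ (fS j).
      by field; rewrite a_neq0 b_neq0 m_neq0.
    + have [-> _] := xT _ (gT i); have [_ ->] := xT _ (gT j); rewrite mE.
      by field; rewrite b_neq0 M_neq0.
(* The diagonal entries of G(-1) are (b - a) or (a - b) times a positive
   factor, according to the block. *)
move=> E1; suff -> : a = b by rewrite divff.
apply/eqP; rewrite eq_le; apply/andP; split.
  have := E1 im im; rewrite two_modeE //.
  have [-> ->] := xT _ imT; rewrite mE.
  rewrite (_ : _ + _ = (b - a) * (p 0 im / b)); last by field; rewrite M_neq0 b_neq0.
  by rewrite pmulr_lge0 ?divr_gt0 // subr_ge0.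
have := E1 iM iM; rewrite two_modeE //.
have [-> ->] := xS _ iMS; rewrite mE.
rewrite (_ : _ + _ = (a - b) * (p 0 iM / a)); last first.
  by field; rewrite a_neq0 M_neq0 b_neq0.
by rewrite pmulr_lge0 ?divr_gt0 // subr_ge0.
Qed.

(** The left eigenvector of the eigenvalue 1 weighs the two blocks by
    alpha / (1 + alpha) and 1 / (1 + alpha), and x is constant on each block. *)
Lemma rank_two_form_two_mode (R : realType) n1 n2 (alpha : R)
    (w : 'cV[R]_n1) (v : 'cV[R]_n2) :
  0 < alpha -> w^T *m ones R n1 = 1%:M -> v^T *m ones R n2 = 1%:M ->
  exists p y x, biorthonormal p y x /\
    forall mu, rank_two_form alpha mu w v = two_mode p y x mu.
Proof.
move=> alpha0 w1 v1.
have alpha1 : 1 + alpha != 0 by rewrite lt0r_neq0 // addr_gt0.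
pose d := (1 + alpha)^-1.
exists (row_mx ((alpha * d) *: w^T) (d *: v^T)), (row_mx w^T (- v^T)),
  (col_mx (d *: ones R n1) (- (alpha * d) *: ones R n2)).
have onesE : ones R (n1 + n2) = col_mx (ones R n1) (ones R n2).
  by rewrite /ones col_mx_const.
split.
  split.
  - rewrite onesE mul_row_col -!scalemxAl w1 v1 -scalerDl.
    by rewrite (_ : _ + _ = 1) ?scale1r // /d; field.
  - rewrite mul_row_col -!scalemxAl -!scalemxAr w1 v1 !scalerA -scalerDl.
    by rewrite (_ : _ + _ = 0) ?scale0r // /d; field.
  - by rewrite onesE mul_row_col mulNmx w1 v1 subrr.
  - rewrite mul_row_col mulNmx -!scalemxAr w1 v1 -scalerBl.
    by rewrite (_ : _ - _ = 1) ?scale1r // /d; field.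
move=> mu; rewrite /rank_two_form /two_mode onesE.
rewrite !mul_col_row !scale_block_mx add_block_mx.
by congr block_mx; apply/matrixP=> i j; rewrite !mxE !big_ord1 !mxE /d; field.
Qed.

Lemma rank_two_form_stochastic (R : realType) n1 n2 (alpha mu : R)
    (w : 'cV[R]_n1) (v : 'cV[R]_n2) :
  0 < alpha -> (forall i, 0 < w i 0) -> (forall j, 0 < v j 0) ->
  w^T *m ones R n1 = 1%:M -> v^T *m ones R n2 = 1%:M ->
  0 <= alpha + mu -> mu <= 1 -> 0 <= 1 + alpha * mu ->
  stochastic (rank_two_form alpha mu w v).
Proof.
move=> alpha0 w0 v0 w1 v1 mu1 mu2 mu3.
split=> [i j|i].
  rewrite /rank_two_form !mxE mulr_ge0 ?invr_ge0 ?addr_ge0 ?(ltW alpha0) //.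
  by case: (split i) => i'; rewrite !mxE; case: (split j) => j';
    rewrite !mxE big_ord1 !mxE mul1r ?mulr_ge0 ?subr_ge0 ?(ltW alpha0)
      ?(ltW (w0 _)) ?(ltW (v0 _)).
have [p [y [x [pyx formE]]]] := rank_two_form_two_mode alpha0 w1 v1.
transitivity ((rank_two_form alpha mu w v *m ones R (n1 + n2)) i 0).
  by rewrite mxE; apply: eq_bigr => j _; rewrite [ones _ _ _ _]mxE mulr1.
by rewrite formE two_mode_ones // mxE.
Qed.

Lemma has_rank_two_form_root (R : realType) n (A : 'M[R]_n) alpha lambda mu c :
  has_rank_two_form alpha lambda A -> 0 < alpha -> (0 < c)%N ->
  mu ^+ c = lambda -> 0 <= alpha + mu -> mu <= 1 -> 0 <= 1 + alpha * mu ->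
  Pplus A c.
Proof.
move=> [n1 [n2 [e [w [v [_ [w0 v0] [w1 v1] simA]]]]]] alpha0 c0 muc m1 m2 m3.
apply: Pplus_perm_similar simA _.
case: n / e {A}; rewrite castmx_id; split=> //.
exists (rank_two_form alpha mu w v); split; first exact: rank_two_form_stochastic.
have [p [y [x [pyx formE]]]] := rank_two_form_two_mode alpha0 w1 v1.
by rewrite !formE two_mode_exp // muc.
Qed.

(** The bounds are the signs of the off-diagonal and of the upper left
    blocks; they place the real roots of lambda in the stochastic range. *)
Lemma has_rank_two_form_bounds (R : realType) n (A : 'M[R]_n) alpha lambda :
  has_rank_two_form alpha lambda A -> 0 < alpha -> (forall i j, 0 <= A i j) ->
  lambda <= 1 /\ - alpha <= lambda.
Proof.
move=> [n1 [n2 [e [w [v [[n1_0 n2_0] [w0 v0] _ simA]]]]]] alpha0 A0.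
have Y0 i j : 0 <= rank_two_form alpha lambda w v i j.
  have [s AE] := perm_similar_entries simA.
  have := A0 ((s^-1)%g (cast_ord e i)) ((s^-1)%g (cast_ord e j)).
  by rewrite AE !permKV castmxE /= !cast_ordK.
have d0 : 0 < (1 + alpha)^-1 by rewrite invr_gt0 addr_gt0.
pose i := Ordinal n1_0; pose j := Ordinal n2_0.
have := Y0 (lshift _ i) (rshift _ j); have := Y0 (lshift _ i) (lshift _ i).
rewrite /rank_two_form scale_block_mx block_mxEul block_mxEur !mxE !big_ord1 !mxE.
rewrite !mul1r ![0 <= _^-1 * _]pmulr_rge0 // !pmulr_lge0 //.
by rewrite subr_ge0 addrC -lerBlDr sub0r.
Qed.

Lemma unit_interval_root (R : realType) (t : R) c :
  (0 < c)%N -> 0 <= t -> t <= 1 -> exists2 m : R, 0 <= m <= 1 & m ^+ c = t.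
Proof.
move=> c0 t0 t1.
have [||m m01 /rootP] := @poly_ivt R ('X^c - t%:P) 0 1.
- by rewrite ler01.
- by rewrite !hornerE expr0n eqn0Ngt c0 expr1n /= subr_ge0 t1 sub0r oppr_le0 t0.
by rewrite !hornerE => /eqP; rewrite subr_eq0 => /eqP <-; exists m.
Qed.

Lemma infinite_odd : infinite_set [set c : nat | odd c].
Proof.
case/finite_fsetP=> X XE; pose N := (\max_(i <- finmap.enum_fset X) i)%N.
have : [set c : nat | odd c] N.*2.+1 by rewrite /= odd_double.
rewrite XE /= => /(@leq_bigmax_seq _ _ xpredT id)-/(_ isT).
by rewrite leqNgt -/N ltnS -addnn leq_addr.
Qed.

Theorem theorem7p1 (R : realType) (n : nat) (A : 'M[R]_n) (lambda : R) :
  stochastic A ->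
  irreducible A ->
  \rank A = 2%N ->
  nonzero_eigenvalues A [:: 1; lambda] ->
  (infinite_set (Pplus A) <->
     exists alpha : R,
       ((0 < lambda /\ 0 < alpha) \/ (lambda < 0 /\ alpha = 1)) /\
       has_rank_two_form alpha lambda A) /\
  (forall alpha : R, 0 < lambda -> 0 < alpha ->
     has_rank_two_form alpha lambda A ->
     Pplus A = [set c : nat | (0 < c)%N]) /\
  (lambda < 0 -> has_rank_two_form 1 lambda A ->
     Pplus A = [set c : nat | odd c]).
Proof.
move=> stA irrA rkA evA; have A0 := stA.1.
have [p [y [x [pyx p0 AE l0 l1]]]] := irreducible_two_mode stA irrA rkA evA.
have pos (alpha : R) : 0 < lambda -> 0 < alpha -> has_rank_two_form alpha lambda A ->
    Pplus A = [set c : nat | (0 < c)%N].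
  move=> lpos alpha0 formA; apply/seteqP; split=> [c [] //|c /= c0].
  have [lle1 _] := has_rank_two_form_bounds formA alpha0 A0.
  have [m /andP[m0 m1] mc] := unit_interval_root c0 (ltW lpos) lle1.
  apply: (has_rank_two_form_root formA alpha0 c0 mc _ m1).
    by rewrite addr_ge0 // ltW.
  by rewrite addr_ge0 // mulr_ge0 // ltW.
have neg : lambda < 0 -> has_rank_two_form 1 lambda A ->
    Pplus A = [set c : nat | odd c].
  move=> lneg formA; apply/seteqP; split=> [c [c0 [B [stB Bc]]]|c /= oddc].
    rewrite AE in Bc.
    have [mu [_ _ _ muc]] :=
      two_mode_root_modes pyx (stochastic_ones stB) l0 l1 c0 Bc.
    apply/negPn/negP => evenc; move: lneg; rewrite -muc ltNge.
    by rewrite exprn_even_ge0 ?evenc.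
  have [_ lgeN1] := has_rank_two_form_bounds formA ltr01 A0.
  have c0 : (0 < c)%N by case: c oddc.
  have [||m /andP[m0 m1] mc] := @unit_interval_root R (- lambda) c c0.
  - by rewrite oppr_ge0 ltW.
  - by rewrite lerNl.
  apply: (@has_rank_two_form_root _ _ _ 1 lambda (- m) _ formA ltr01 c0).
  - by rewrite exprNn -signr_odd oddc expr1 mc mulN1r opprK.
  - by rewrite subr_ge0.
  - by rewrite (le_trans _ ler01) // oppr_le0.
  - by rewrite mul1r subr_ge0.
split; last by split.
split=> [Pinf|[alpha [[[lpos alpha0]|[lneg alpha1]] formA]]].
- rewrite AE in Pinf *.
  have [E0 E1] := two_mode_infinite_root pyx p0 l0 l1 Pinf.
  have [alpha [alpha0 formA alphaE]] := two_mode_has_form pyx p0 E0.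
  exists alpha; split=> //.
  have [lneg|lpos|l_eq0] := ltrgtP lambda 0; last by rewrite l_eq0 eqxx in l0.
    by right; split=> //; apply: alphaE; exact: E1.
  by left.
- rewrite (pos alpha) // => /sub_finite_set fin; apply: infinite_odd.
  by apply: fin => c; case: c.
- rewrite neg //; first exact: infinite_odd.
  by rewrite -alpha1.
Qed.
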